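(* Let $X$ be a compact metric space (endowed with the metric $d$) and let $(T_{n})_{n}$ be a sequence of sublinear and monotone operators from $C(X)$ into itself such that $$T_{n}(1)(x)\rightarrow 1\quad\text{uniformly on }X.$$ Suppose that $\gamma:X\times X\rightarrow\mathbb{R}$ is a separating function such that $$T_{n}(\gamma_{x})(x)\rightarrow 0\quad\text{uniformly with respect to }x\in X,$$ where, for each $x\in X$, $\gamma_{x}:X\to\mathbb{R}$ is the function $\gamma_{x}(y)=\gamma(x,y)$. Then for all nonnegative functions $f\in C(X)$, $$T_{n}(f)\rightarrow f\quad\text{uniformly on }X.$$ Moreover, this convergence holds for all $f\in C(X)$ if the operators $T_{n}$ are also translatable.
   Context: $C(X)$ is the space of all real-valued continuous functions on $X$, with the pointwise order; $1$ denotes the constant function equal to one. A separating function on $X$ is a continuous nonnegative function $\gamma:X\times X\to\mathbb{R}$ such that $\gamma(x,y)=0$ implies $x=y$ (the converse is not required). A (not necessarily linear) operator $T:C(X)\to C(X)$ is called: - sublinear if $T(f+g)\leq T(f)+T(g)$ and $T(af)=aT(f)$ for all $f,g\in C(X)$ and all real $a\geq 0$; - monotone if $f\leq g$ implies $T(f)\leq T(g)$; - translatable if $T(f+\alpha\cdot 1)=T(f)+\alpha T(1)$ for all $f\in C(X)$ and all real $\alpha\geq 0$. *)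

(* Defs.v *)
From HB Require Import structures.
From mathcomp Require Import all_boot all_order all_algebra.
From mathcomp Require Import all_classical all_reals all_analysis.

Set Implicit Arguments.
Unset Strict Implicit.
Unset Printing Implicit Defensive.

Import Order.TTheory GRing.Theory Num.Theory.
Import numFieldNormedType.Exports.

Local Open Scope classical_set_scope.
Local Open Scope ring_scope.

(* C(X) is [continuousType X R], the library's type of bundled continuous
   functions.  The instances below let [f \+ g], [cst a \* f] and
   [gamma \o pair x] denote elements of it. *)
Section continuous_ops.
Context {R : realType} {X : topologicalType} (f g : continuousType X R).

Let continuous_add_fun : continuous (f \+ g).
Proof. by move=> x; apply: continuousD; exact: cts_fun. Qed.

HB.instance Definition _ := @isContinuous.Build X R (f \+ g) continuous_add_fun.

Let continuous_mul_fun : continuous (f \* g).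
Proof. by move=> x; apply: continuousM; exact: cts_fun. Qed.

HB.instance Definition _ := @isContinuous.Build X R (f \* g) continuous_mul_fun.

End continuous_ops.

Section continuous_pair.
Context {X Y : topologicalType} (x : X).

Let continuous_pair : continuous (@pair X Y x).
Proof. by move=> y; apply: cvg_pair => //=; exact: cvg_cst. Qed.

HB.instance Definition _ :=
  @isContinuous.Build Y (X * Y)%type (@pair X Y x) continuous_pair.

End continuous_pair.

Section operators.
Context {R : realType} {X : topologicalType}.
Implicit Types (f g : continuousType X R).

Definition C_le f g : Prop := forall x, f x <= g x.

(* [gamma x x = 0] is deliberately not required. *)
Definition separating_fun (gamma : continuousType (X * X)%type R) : Prop :=
  (forall p, 0 <= gamma p) /\ (forall x y, gamma (x, y) = 0 -> x = y).

Definition slice (gamma : continuousType (X * X)%type R) (x : X)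
  : continuousType X R := gamma \o pair x.

Implicit Type T : continuousType X R -> continuousType X R.

Definition sublinear_op T : Prop :=
  (forall f g, C_le (T (f \+ g)) (T f \+ T g)) /\
  (forall (a : R) f, 0 <= a -> T (cst a \* f) = cst a \* T f).

Definition monotone_op T : Prop := forall f g, C_le f g -> C_le (T f) (T g).

Definition translatable_op T : Prop :=
  forall f (a : R), 0 <= a ->
    T (f \+ (cst a \* cst 1)) = T f \+ (cst a \* T (cst 1)).

End operators.

(* Main.v *)
Require Import Defs.
From mathcomp Require Import all_boot all_order all_algebra.
From mathcomp Require Import all_classical all_reals all_analysis.
From mathcomp Require Import ring lra.

Import Order.TTheory GRing.Theory Num.Theory.
Import numFieldNormedType.Exports.

Local Open Scope classical_set_scope.
Local Open Scope ring_scope.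

(** Korovkin's argument with [gamma] in the role of the square of the distance.
    On a compact space a separating function controls oscillation: for every
    [e > 0] there is [d] with [`|f y - f x| < e + d * gamma (x, y)] for all
    [x] and [y] ([osc_le_separating]).  For a fixed [x], read this as two
    inequalities between functions of [y], [f <= f x + e + d * gamma_x] and
    [f x <= f + e + d * gamma_x], apply a monotone sublinear [S] to both, and
    evaluate at [x] itself.  When [f x >= 0], homogeneity gives
    [S (f x) = f x * S 1], and the result ([korovkin_estimate]) is

      [`|f x - S f x| <= `|f x| * `|1 - S 1 x| + e * S 1 x + d * S gamma_x x],

    whose right-hand side is small, uniformly in [x], by the two test
    hypotheses.

    Homogeneity is available for nonnegative scalars only, hence the sign
    condition on [f].  A translatable operator satisfies
    [S (f + c) = S f + c * S 1] for [c >= 0], so an arbitrary [f] is reduced to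
    the nonnegative function [f + c], where [c] bounds [`|f|]. *)

Lemma uniform_cvgP (R : realType) (X : choiceType) (F : nat -> X -> R)
    (f : X -> R) :
  {uniform, F @ \oo --> f} <->
  forall e : R, 0 < e -> \forall n \near \oo, forall x, `|f x - F n x| < e.
Proof.
split=> [Ff e e0|Ff P /uniform_nbhs [E [+ EP]]].
- apply: (Ff [set h | forall x, `|f x - h x| < e]); apply/uniform_nbhs.
  exists [set p : R * R | `|p.1 - p.2| < e]; split=> /=.
    by rewrite -entourage_ballE; exists e.
  by move=> h fh x; exact: fh.
- rewrite -entourage_ballE => -[e /= e0 eE].
  have := Ff _ e0; apply: filterS => n fF.
  by apply: EP => x _; apply: eE; exact: fF.
Qed.

Lemma compact_near_bounded (R : realType) (X : topologicalType)
    (f : continuousType X R) :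
  compact [set: X] -> \forall c \near +oo, forall x, `|f x| < c.
Proof.
move=> /compact_near_coveringP cX.
have : \forall c \near +oo, [set: X] `<=` (fun x => `|f x| < c).
  apply: cX => x _.
  have fx1 : \forall y \near x, `|f y| < `|f x| + 1.
    by apply: (cvgr_norm_lt (f x)); [exact: cts_fun | rewrite ltrDl].
  near=> y c => /=; apply: (@lt_trans _ _ (`|f x| + 1)); first by near: y.
  by near: c; exact: nbhs_pinfty_gt.
by apply: filterS => c cf x; exact: cf.
Unshelve. all: by end_near. Qed.

(** Compactness reduces the claim to a neighbourhood of each [(x, y)].  On the
    diagonal continuity of [f] suffices, whatever the value of [gamma]; off the
    diagonal [gamma (x, y) > 0], so that a large [d] absorbs the bounded
    left-hand side. *)
Lemma osc_le_separating (R : realType) (X : topologicalType)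
    (f : continuousType X R) (gamma : continuousType (X * X)%type R) (e : R) :
  compact [set: X] -> separating_fun gamma -> 0 < e ->
  exists2 d, 0 < d & forall x y, `|f y - f x| < e + d * gamma (x, y).
Proof.
move=> cX [g0 gsep] e0.
have /compact_near_coveringP cXX := compact_setX cX cX.
suff : \forall d \near +oo,
    [set: X] `*` [set: X] `<=` (fun p => `|f p.2 - f p.1| < e + d * gamma p).
  move=> H; near (pinfty_nbhs R) => d; exists d.
    by near: d; exact: nbhs_pinfty_gt.
  move=> x y; have P : [set: X] `*` [set: X] `<=`
      (fun p => `|f p.2 - f p.1| < e + d * gamma p) by near: d; exact: H.
  exact: (P (x, y)).
apply: cXX => -[x y] _.
have df : (fun p : X * X => f p.2 - f p.1) @ (x, y) --> f y - f x.
  apply: cvgB; (apply: cvg_comp; last exact: cts_fun);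
    [exact: cvg_snd | exact: cvg_fst].
have [xy|xy] := eqVneq x y.
- near=> p d => /=; apply: (@lt_le_trans _ _ e).
    near: p; apply: (cvgr_norm_lt (f y - f x)) => //.
    by rewrite xy subrr normr0.
  by rewrite lerDl mulr_ge0 //; near: d; exact: nbhs_pinfty_ge.
- have gxy : 0 < gamma (x, y).
    by rewrite lt_neqAle g0 andbT eq_sym; apply/eqP => /gsep /eqP; apply/negP.
  (* Near [(x, y)], [C] bounds the oscillation above and [c] bounds [gamma]
     below. *)
  set C := `|f y - f x| + 1; set c := gamma (x, y) / 2.
  have c0 : 0 < c by rewrite divr_gt0.
  near=> p d => /=.
  have pC : `|f p.2 - f p.1| < C.
    by near: p; apply: (cvgr_norm_lt (f y - f x)) => //; rewrite ltrDl.
  have pc : c < gamma p.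
    near: p; apply: (cvgr_gt (gamma (x, y))); first exact: cts_fun.
    by rewrite /c ltr_pdivrMr // mulr_natr mulr2n ltrDl.
  have dC : C / c < d.
    by near: d; apply: nbhs_pinfty_gt; rewrite num_real.
  have d0 : 0 < d by apply: lt_trans dC; rewrite divr_gt0 // ltr_wpDl.
  apply: (lt_trans pC); apply: (@lt_trans _ _ (d * gamma p)); last first.
    by rewrite ltrDr.
  by apply: (@lt_trans _ _ (d * c)); rewrite ?ltr_pM2l // -ltr_pdivrMr.
Unshelve. all: by end_near. Qed.

Section korovkin.
Context {R : realType} {X : topologicalType}.
Variable S : continuousType X R -> continuousType X R.
Hypotheses (subS : sublinear_op S) (monS : monotone_op S).

Lemma sublinear_opZ (a : R) (f : continuousType X R) x :
  0 <= a -> S (cst a \* f) x = a * S f x.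
Proof. by move=> a0; rewrite (subS.2 a f a0). Qed.

(** The single inequality behind both halves of [korovkin_estimate]: the
    constant function [f x] takes the place of [g] in one and of [f] in the
    other. *)
Lemma sublinear_op_le (f g k : continuousType X R) (a b : R) :
  0 <= a -> 0 <= b -> (forall y, f y <= g y + (a + b * k y)) ->
  forall x, S f x <= S g x + (a * S (cst 1) x + b * S k x).
Proof.
move=> a0 b0 fgk x.
have /monS /(_ x) : C_le f (g \+ (cst a \* cst 1 \+ cst b \* k)).
  by move=> y /=; rewrite mulr1.
move/le_trans; apply; apply: (le_trans (subS.1 _ _ x)) => /=.
rewrite lerD2l; apply: (le_trans (subS.1 _ _ x)) => /=.
by rewrite !sublinear_opZ.
Qed.

(** The operator is applied in the variable [y] with [x] fixed, and only then
    evaluated at [x].  The term [`|f x| * `|1 - S 1 x|] is the error made on the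
    constant function [f x]; it needs [0 <= f x] because [S] is homogeneous for
    nonnegative scalars only. *)
Lemma korovkin_estimate (f k : continuousType X R) (e d : R) x :
  0 <= f x -> 0 <= e -> 0 <= d ->
  (forall y, `|f y - f x| <= e + d * k y) ->
  `|f x - S f x| <= `|f x| * `|1 - S (cst 1) x| + (e * S (cst 1) x + d * S k x).
Proof.
move=> fx0 e0 d0 osc.
have up : S f x <= f x * S (cst 1) x + (e * S (cst 1) x + d * S k x).
  rewrite -sublinear_opZ //; apply: sublinear_op_le => // y /=.
  by rewrite mulr1; have := osc y; rewrite ler_norml => /andP[_]; lra.
have down : f x * S (cst 1) x <= S f x + (e * S (cst 1) x + d * S k x).
  rewrite -sublinear_opZ //; apply: sublinear_op_le => // y /=.
  by rewrite mulr1; have := osc y; rewrite ler_norml => /andP[+ _];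
    clear up; lra.
rewrite -normrM mulrBr mulr1.
have := lexx `|f x - f x * S (cst 1) x|; rewrite ler_norml => /andP[lo hi].
rewrite ler_norml; move: (f x * _) (d * _) (e * _) (S f x) up down lo hi.
by clear => a b c t; lra.
Qed.

End korovkin.

Section korovkin_sequence.
Context {R : realType} {X : topologicalType}.
Variables (T : nat -> continuousType X R -> continuousType X R)
  (gamma : continuousType (X * X)%type R).
Hypotheses (cptX : compact [set: X])
  (subT : forall n, sublinear_op (T n)) (monT : forall n, monotone_op (T n))
  (cvgT1 : {uniform, (fun n => T n (cst 1) : X -> R) @ \oo
                       --> (cst 1 : X -> R)})
  (sepg : separating_fun gamma)
  (cvgTg : {uniform, (fun n => (fun x => T n (slice gamma x) x) : X -> R)
                       @ \oo --> (cst 0 : X -> R)}).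

(** The estimate is applied with oscillation constant [e / 4].  For [n] large
    its three terms are at most [e / 4], [e / 4 * 2] and [e / 4], the last
    strictly.  Uniformity in [x] comes from the bound [M] on [`|f|] and from the
    independence of [d] from [x]. *)
Lemma korovkin_nonneg (f : continuousType X R) :
  (forall x, 0 <= f x) ->
  {uniform, (fun n => T n f : X -> R) @ \oo --> (f : X -> R)}.
Proof.
move=> f0; apply/uniform_cvgP => e e0.
have [M M0 fM] : exists2 M, 0 < M & forall x, `|f x| < M.
  near (pinfty_nbhs R) => M; exists M.
    by near: M; exact: nbhs_pinfty_gt.
  by near: M; exact: compact_near_bounded.
have e4 : 0 < e / 4 by rewrite divr_gt0.
have [d d0 osc] := osc_le_separating _ _ f _ _ cptX sepg e4.
move/uniform_cvgP : cvgTg => /(_ (e / 4 / d)) Tg.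
move/uniform_cvgP : cvgT1 => T1.
have T1' := T1 _ ltr01; have {}T1 := T1 (e / 4 / M).
near=> n => x.
have Tg_n : `|0 - T n (slice gamma x) x| < e / 4 / d.
  by move: x; near: n; apply: Tg; rewrite divr_gt0.
have T1_n : `|1 - T n (cst 1) x| < e / 4 / M.
  by move: x {Tg_n}; near: n; apply: T1; rewrite divr_gt0.
(* This keeps [T n (cst 1) x] below 2. *)
have T1_n' : `|1 - T n (cst 1) x| < 1 by move: x {Tg_n T1_n}; near: n.
apply: (@le_lt_trans _ _ (`|f x| * `|1 - T n (cst 1) x| +
    (e / 4 * T n (cst 1) x + d * T n (slice gamma x) x))).
  apply: korovkin_estimate => //; [exact: ltW | exact: ltW | move=> y].
  exact/ltW/osc.
have B1 : `|f x| * `|1 - T n (cst 1) x| <= e / 4.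
  rewrite -(divfK (lt0r_neq0 M0) (e / 4)) mulrC.
  by apply: ler_pM => //; exact: ltW.
have B2 : e / 4 * T n (cst 1) x <= e / 4 * 2.
  by rewrite ler_pM2l //; move: T1_n'; rewrite ltr_norml => /andP[]; lra.
have B3 : d * T n (slice gamma x) x < e / 4.
  rewrite mulrC -ltr_pdivlMr //; apply: le_lt_trans Tg_n.
  by rewrite sub0r normrN ler_norm.
by move: e0 B1 B2 B3; lra.
Unshelve. all: by end_near. Qed.

(** With [c] a bound of [`|f|], translatability rewrites [f - T n f] as
    [(f + c) - T n (f + c)] minus the error [c * (1 - T n 1)] on constants. *)
Lemma korovkin_translatable (f : continuousType X R) :
  (forall n, translatable_op (T n)) ->
  {uniform, (fun n => T n f : X -> R) @ \oo --> (f : X -> R)}.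
Proof.
move=> trT; apply/uniform_cvgP => e e0.
have [c c0 fc] : exists2 c, 0 < c & forall x, `|f x| < c.
  near (pinfty_nbhs R) => c; exists c.
    by near: c; exact: nbhs_pinfty_gt.
  by near: c; exact: compact_near_bounded.
have fc0 x : 0 <= (f \+ (cst c \* cst 1)) x.
  by rewrite /= mulr1; have := fc x; rewrite ltr_norml => /andP[]; lra.
have /uniform_cvgP /(_ (e / 2)) Tfc := korovkin_nonneg _ fc0.
move/uniform_cvgP : cvgT1 => /(_ (e / 2 / c)) T1.
have e2 : 0 < e / 2 by rewrite divr_gt0.
near=> n => x.
have Tfc_n :
    `|(f \+ (cst c \* cst 1)) x - T n (f \+ (cst c \* cst 1)) x| < e / 2.
  by move: x; near: n; exact: Tfc.
have T1_n : c * `|1 - T n (cst 1) x| < e / 2.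
  rewrite mulrC -ltr_pdivlMr //.
  by move: x {Tfc_n}; near: n; apply: T1; rewrite divr_gt0.
move: Tfc_n; rewrite trT ?ltW //= mulr1 => Tfc_n.
have -> : f x - T n f x = (f x + c - (T n f x + c * T n (cst 1) x)) -
    c * (1 - T n (cst 1) x) by ring.
apply: (le_lt_trans (ler_normB _ _)).
by rewrite normrM (gtr0_norm c0); lra.
Unshelve. all: by end_near. Qed.

End korovkin_sequence.

Theorem theorem2 (R : realType) (X : metricType R)
    (cptX : compact [set: X])
    (T : nat -> continuousType X R -> continuousType X R)
    (subT : forall n, sublinear_op (T n))
    (monT : forall n, monotone_op (T n))
    (cvgT1 : {uniform, (fun n => T n (cst 1) : X -> R) @ \oo
                         --> (cst 1 : X -> R)})
    (gamma : continuousType (X * X)%type R)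
    (sepg : separating_fun gamma)
    (cvgTg : {uniform, (fun n => (fun x => T n (slice gamma x) x) : X -> R)
                         @ \oo --> (cst 0 : X -> R)}) :
  (forall f : continuousType X R, (forall x, 0 <= f x) ->
     {uniform, (fun n => T n f : X -> R) @ \oo --> (f : X -> R)}) /\
  ((forall n, translatable_op (T n)) ->
   forall f : continuousType X R,
     {uniform, (fun n => T n f : X -> R) @ \oo --> (f : X -> R)}).
Proof.
split=> [|trT f].
  exact: korovkin_nonneg cptX subT monT cvgT1 sepg cvgTg.
exact: korovkin_translatable cptX subT monT cvgT1 sepg cvgTg f trT.
Qed.
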